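(* Let $\Gamma$ be a finite simple connected bipartite graph with bipartition $X=\{x_1,\ldots,x_m\}$, $Y=\{y_1,\ldots,y_n\}$ (with this labeling of the vertices). Then the output $M_1,\ldots,M_k$ of the slope algorithm applied to this labeled graph is a positive matching decomposition of $\Gamma$.
   Context: A matching $M$ (a set of pairwise disjoint edges) of a graph $\Gamma=(V,E)$ is positive if there is $w\colon V\to\mathbb{R}$ with $w(u)+w(v)>0$ for every $uv\in M$ and $w(u)+w(v)<0$ for every $uv\in E\setminus M$. A positive matching decomposition (pmd) of $\Gamma$ is a partition $E=E_1\cup\cdots\cup E_p$ into pairwise disjoint subsets such that $E_i$ is a positive matching of $(V,E\setminus\bigcup_{j<i}E_j)$ for $i=1,\ldots,p$. Slope algorithm. For a bipartite graph with labeled parts $X=\{x_1,\ldots,x_m\}$ and $Y=\{y_1,\ldots,y_n\}$, the slope of an edge $x_iy_j$ is $s(x_iy_j)=j-i$. Start with $k=0$ and the edge set $E(\Gamma)$. While $E(\Gamma)\neq\varnothing$, perform one outer round: increase $k$ by $1$; let $X'$ be the set of vertices of $X$ that are not isolated in the current graph $\Gamma$; let $Y'=\varnothing$ and $M_k=\varnothing$. While $X'\neq\varnothing$: let $s$ be the minimum slope of the edges of the induced subgraph $\Gamma[X'\cup Y]$ of the current graph; let $M$ be the set of all edges of $\Gamma[X'\cup Y]$ with slope $s$; add to $M_k$ all edges $xy\in M$ (with $x\in X$, $y\in Y$) such that $y\notin Y'$; then remove from $X'$ all vertices $x$ with $xy\in M$ for some $y$; then add to $Y'$ all vertices $y$ with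 $xy\in M$ for some $x$. When $X'=\varnothing$, replace $E(\Gamma)$ by $E(\Gamma)\setminus M_k$, which ends the outer round. When $E(\Gamma)=\varnothing$, return $M_1,\ldots,M_k$. *)

(* Defs.v *)
From HB Require Import structures.
From mathcomp Require Import all_boot all_order all_algebra.
From mathcomp Require Import reals.

Set Implicit Arguments.
Unset Strict Implicit.
Unset Printing Implicit Defensive.

Import Order.TTheory GRing.Theory Num.Theory.
Local Open Scope ring_scope.

(* A finite simple graph on V is a symmetric irreflexive e : rel V.  Edges are
   the two-element sets [set u; v], and a graph (V, E) is given by its edge set
   E : {set {set V}}. *)
Definition edge_set (V : finType) (e : rel V) : {set {set V}} :=
  [set [set p.1; p.2] | p : V * V & e p.1 p.2].

Definition connected (V : finType) (e : rel V) : Prop :=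
  forall u v, connect e u v.

Definition matching (V : finType) (E M : {set {set V}}) : Prop :=
  M \subset E /\ trivIset M.

Definition positive_matching (R : realType) (V : finType)
    (E M : {set {set V}}) : Prop :=
  matching E M /\
  exists w : V -> R,
    (forall u v, [set u; v] \in M -> 0 < w u + w v) /\
    (forall u v, [set u; v] \in E :\: M -> w u + w v < 0).

(* Since Es has no repetition, [partition] of its set of members says that the
   E_i are nonempty, pairwise disjoint for distinct indices, and cover E. *)
Definition pmd (R : realType) (V : finType) (E : {set {set V}})
    (Es : seq {set {set V}}) : Prop :=
  [/\ uniq Es,
      partition [set M in Es] E
    & forall i, (i < size Es)%N ->
        positive_matching R (E :\: \bigcup_(j < i) nth set0 Es j)
                            (nth set0 Es i)].

Definition labeled_bipartition (V : finType) (e : rel V) (m n : nat)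
    (x : 'I_m -> V) (y : 'I_n -> V) : Prop :=
  [/\ injective x /\ injective y,
      forall i j, x i <> y j,
      forall v, (exists i, v = x i) \/ (exists j, v = y j),
      forall i i', ~~ e (x i) (x i')
    & forall j j', ~~ e (y j) (y j')].

(* [while fuel c f s] runs "while c do f" from s, for at most fuel iterations.
   Both loops below get enough fuel to stop because their guard fails: see
   [round_loop_exit] and [slope_loop_exit]. *)
Fixpoint while (S : Type) (fuel : nat) (c : S -> bool) (f : S -> S) (s : S) :=
  if fuel is k.+1 then if c s then while k c f (f s) else s else s.

(* The pair (i, j) stands for the edge between x_i and y_j.  Ordinals number
   both parts from 0 instead of 1, which leaves j - i unchanged. *)
Local Notation edge m n := ('I_m * 'I_n)%type.

Definition slope (m n : nat) (p : edge m n) : int :=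
  (p.2 : nat)%:Z - (p.1 : nat)%:Z.

Definition min_slope_edges (m n : nat) (F : {set edge m n}) : {set edge m n} :=
  [set p in F | [forall q in F, slope p <= slope q]].

(* The edges of the subgraph of G induced by X' and all of Y. *)
Definition induced_edges (m n : nat) (G : {set edge m n}) (X' : {set 'I_m}) :
    {set edge m n} :=
  [set p in G | p.1 \in X'].

(* The state is (X', Y', M_k). *)
Definition round_step (m n : nat) (G : {set edge m n})
    (st : {set 'I_m} * {set 'I_n} * {set edge m n}) :=
  let: (X', Y', Mk) := st in
  let M := min_slope_edges (induced_edges G X') in
  (X' :\: [set p.1 | p in M],
   Y' :|: [set p.2 | p in M],
   Mk :|: [set p in M | p.2 \notin Y']).

Definition round_loop (m n : nat) (G : {set edge m n}) :=
  let X0 := [set p.1 | p in G] in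
  while #|X0| (fun st => st.1.1 != set0) (round_step G) (X0, set0, set0).

Definition slope_round (m n : nat) (G : {set edge m n}) : {set edge m n} :=
  (round_loop G).2.

(* The state is (current edge set, [:: M_1; ...; M_k]). *)
Definition slope_step (m n : nat) (st : {set edge m n} * seq {set edge m n}) :=
  let: (G, Ms) := st in
  let Mk := slope_round G in (G :\: Mk, rcons Ms Mk).

Definition slope_loop (m n : nat) (G : {set edge m n}) :=
  while #|G| (fun st => st.1 != set0) (@slope_step m n) (G, [::]).

Definition slope_algorithm (m n : nat) (G : {set edge m n}) : seq {set edge m n} :=
  (slope_loop G).2.

Lemma while_exit (S : Type) (I : S -> Prop) (mu : S -> nat)
    (c : S -> bool) (f : S -> S) fuel s :
  (forall t, I t -> c t -> I (f t) /\ (mu (f t) < mu t)%N) ->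
  I s -> (mu s <= fuel)%N -> ~~ c (while fuel c f s).
Proof.
move=> step; elim: fuel s => [|k IH] s Is le_mu /=.
  apply/negP => cs; have [_] := step s Is cs.
  by rewrite ltnNge (leq_trans le_mu).
case: ifPn => // cs; have [Ifs lt_mu] := step s Is cs.
by apply: IH => //; rewrite -ltnS (leq_trans lt_mu).
Qed.

Lemma min_slope_edges_neq0 (m n : nat) (F : {set edge m n}) :
  F != set0 -> min_slope_edges F != set0.
Proof.
case/set0Pn => p0 Fp0.
have [p Fp min_p] := Order.TotalTheory.arg_minP (@slope m n) Fp0.
apply/set0Pn; exists p; rewrite inE; apply/andP; split=> //.
by apply/forall_inP.
Qed.

Lemma round_loop_exit (m n : nat) (G : {set edge m n}) :
  (round_loop G).1.1 = set0.
Proof.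
apply/eqP; rewrite -[_ == _]negbK.
apply: (@while_exit _
  (fun st : {set 'I_m} * {set 'I_n} * {set edge m n} =>
     st.1.1 \subset [set p.1 | p in G])
  (fun st => #|st.1.1|) (fun st => st.1.1 != set0)) => //.
case=> -[X' Y'] Mk /= sX /set0Pn[i Xi].
split; first by apply: subset_trans (subsetDl _ _) sX.
have /imsetP[p Gp ip] := subsetP sX i Xi.
have /set0Pn[q Mq] : min_slope_edges (induced_edges G X') != set0.
  apply: min_slope_edges_neq0; apply/set0Pn; exists p.
  by rewrite inE Gp -ip Xi.
apply: proper_card; rewrite properE subsetDl; apply/subsetPn; exists q.1.
  by move: Mq; rewrite !inE => /andP[/andP[]].
by rewrite inE imset_f.
Qed.

Lemma round_accum (m n : nat) (G : {set edge m n}) fuel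
    (st : {set 'I_m} * {set 'I_n} * {set edge m n}) :
  st.2 \subset (while fuel (fun st => st.1.1 != set0) (round_step G) st).2.
Proof.
elim: fuel st => [|k IH] st //=; case: ifP => // _.
apply: subset_trans (IH _); case: st => -[X' Y'] Mk /=.
exact: subsetUl.
Qed.

Lemma slope_round_meets (m n : nat) (G : {set edge m n}) :
  G != set0 -> G :&: slope_round G != set0.
Proof.
move=> G0; have [p Gp] := set0Pn _ G0.
have X0 : p.1 \in [set q.1 | q in G] by rewrite imset_f.
rewrite /slope_round /round_loop.
have -> : #|[set q.1 | q in G]| = (#|[set q.1 | q in G]|.-1).+1.
  by rewrite prednK // card_gt0; apply/set0Pn; exists p.1.
rewrite /=; case: ifP => [_|/negbT]; last first.
  by rewrite negbK => /eqP X00; rewrite X00 inE in X0.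
have indG : induced_edges G [set q.1 | q in G] = G.
  apply/setP => q; rewrite inE andb_idr // => Gq; exact: imset_f.
have /set0Pn[q Mq] := min_slope_edges_neq0 G0.
apply/set0Pn; exists q; rewrite inE; apply/andP; split.
  by move: Mq; rewrite inE => /andP[].
apply: (subsetP (round_accum _ _ _)).
by rewrite /= indG !inE andbT; move: Mq; rewrite inE.
Qed.

Lemma slope_loop_exit (m n : nat) (G : {set edge m n}) : (slope_loop G).1 = set0.
Proof.
apply/eqP; rewrite -[_ == _]negbK.
apply: (@while_exit _ (fun _ : {set edge m n} * seq {set edge m n} => True)
  (fun st => #|st.1|) (fun st => st.1 != set0)) => //.
case=> H Ms _ /= /slope_round_meets /set0Pn[q].
rewrite inE => /andP[Hq Mq]; split=> //; apply: proper_card.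
rewrite properE subsetDl; apply/subsetPn; exists q => //.
by rewrite inE Mq.
Qed.

Definition bipartite_edges (V : finType) (e : rel V) (m n : nat)
    (x : 'I_m -> V) (y : 'I_n -> V) : {set 'I_m * 'I_n} :=
  [set p | e (x p.1) (y p.2)].

Definition edges_of_pairs (V : finType) (m n : nat)
    (x : 'I_m -> V) (y : 'I_n -> V) (M : {set 'I_m * 'I_n}) : {set {set V}} :=
  [set [set x p.1; y p.2] | p in M].

Definition slope_output (V : finType) (e : rel V) (m n : nat)
    (x : 'I_m -> V) (y : 'I_n -> V) : seq {set {set V}} :=
  [seq edges_of_pairs x y M | M <- slope_algorithm (bipartite_edges e x y)].

(* Main.v *)
Require Import Defs.
From HB Require Import structures.
From mathcomp Require Import all_boot all_order all_algebra.
From mathcomp Require Import lra.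
From mathcomp Require Import reals.

(** One round of the algorithm has a closed description.  Every [x_i] that is
    not isolated in the current graph leaves [X'] at the smallest slope of its
    own edges, that is, through the edge to its neighbour [y_j] of least index:
    call this edge leftmost.  Among the leftmost edges at one [y_j], the
    smallest slope belongs to the largest [i], and that edge is accepted while
    the later ones find [y_j] already in [Y'].  So a round returns the leftmost
    edges that are lowest at their end in [Y] ([slope_round_lowest]).

    This set is a matching.  It is positive because the pairs [(j, i)], ordered
    lexicographically, serve as weights: give [x_i] the rank of its leftmost
    edge, and [y_j] the opposite of the rank of the lowest leftmost edge that
    it receives, up to a small constant.  The two ranks agree on a selected
    edge.  On any other edge [x_i y_j] the rank at [x_i] is smaller: either the
    leftmost neighbour of [x_i] comes before [y_j], or it is [y_j], which is
    then the end of a leftmost edge with larger [i].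

    Finally, rounds compose: a nonempty positive matching followed by a
    decomposition of the remaining edges is a decomposition ([pmd_cons]). *)

Set Implicit Arguments.
Unset Strict Implicit.
Unset Printing Implicit Defensive.

Import Order.TTheory GRing.Theory Num.Theory.
Local Open Scope ring_scope.

(** * Composing positive matching decompositions *)

Lemma pmd_nil (R : realType) (V : finType) : @pmd R V set0 [::].
Proof.
split=> //; apply/and3P; split.
- rewrite /cover big1 // => M; by rewrite inE.
- by apply/trivIsetP => M; rewrite inE.
- by rewrite inE.
Qed.

Lemma pmd_cons (R : realType) (V : finType) (E M : {set {set V}}) Es :
  M != set0 -> positive_matching R E M -> pmd R (E :\: M) Es ->
  pmd R E (M :: Es).
Proof.
move=> M0 posM [uEs partEs posEs].
have sME : M \subset E by case: posM => -[].
have disM : [disjoint M & E :\: M].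
  by rewrite -setI_eq0 setIDA setIC -setIDA setDv setI0.
split.
- rewrite /= uEs andbT; apply/negP => EsM; move/negP: M0; apply.
  have sM : M \subset E :\: M.
    by rewrite -(cover_partition partEs); apply: bigcup_sup; rewrite inE.
  by move: disM; rewrite -setI_eq0 (setIidPl sM).
- have -> : [set N in M :: Es] = M |: [set N in Es].
    by apply/setP => N; rewrite !inE.
  rewrite -(setID E M) (setIidPr sME).
  exact: partitionU1.
case=> [_|i lti] /=; first by rewrite big_ord0 setD0.
by rewrite big_ord_recl /= -setDDl; apply: posEs.
Qed.

(** * The edges selected by one round *)

Definition leftmost (m n : nat) (G : {set 'I_m * 'I_n}) : {set 'I_m * 'I_n} :=
  [set p in G | [forall q in G, (q.1 == p.1) ==> (p.2 <= q.2)%N]].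

(** Rows are counted downwards: the lowest edge at [y_j] has the largest [i],
    hence the smallest slope. *)
Definition lowest (m n : nat) (L : {set 'I_m * 'I_n}) : {set 'I_m * 'I_n} :=
  [set p in L | [forall q in L, (q.2 == p.2) ==> (q.1 <= p.1)%N]].

Section Round.
Variables (m n : nat) (G : {set 'I_m * 'I_n}).
Implicit Types p q : 'I_m * 'I_n.

Lemma leftmostP p :
  reflect (p \in G /\ forall q, q \in G -> q.1 = p.1 -> (p.2 <= q.2)%N)
          (p \in leftmost G).
Proof.
rewrite inE; apply: (iffP andP) => -[Gp H]; split=> //.
  by move=> q Gq /eqP; apply/implyP; apply: (forall_inP H).
by apply/forall_inP => q Gq; apply/implyP => /eqP; apply: H.
Qed.

Lemma leftmost_inj p q :
  p \in leftmost G -> q \in leftmost G -> p.1 = q.1 -> p = q.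
Proof.
move=> /leftmostP[Gp minp] /leftmostP[Gq minq] eq1.
have /eqP eq2 : nat_of_ord p.2 == q.2.
  by rewrite eqn_leq minp //= minq.
case: p q eq1 eq2 {Gp Gq minp minq} => [i j] [i' j'] /= -> /val_inj -> //.
Qed.

Lemma leftmost_ex p :
  p \in G -> exists2 q, q \in leftmost G & q.1 = p.1 /\ (q.2 <= p.2)%N.
Proof.
move=> Gp; have Pp : (p \in G) && (p.1 == p.1) by rewrite Gp eqxx.
case: (@arg_minnP _ p (fun q => (q \in G) && (q.1 == p.1))
                  (fun q => nat_of_ord q.2) Pp).
move=> q /andP[Gq /eqP qp] minq; exists q; last by split=> //; apply: minq.
by apply/leftmostP; split=> // r Gr rq; apply: minq; rewrite Gr rq qp eqxx.
Qed.
End Round.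

Lemma lowestP m n (L : {set 'I_m * 'I_n}) p :
  reflect (p \in L /\ forall q, q \in L -> q.2 = p.2 -> (q.1 <= p.1)%N)
          (p \in lowest L).
Proof.
rewrite inE; apply: (iffP andP) => -[Lp H]; split=> //.
  by move=> q Lq /eqP; apply/implyP; apply: (forall_inP H).
by apply/forall_inP => q Lq; apply/implyP => /eqP; apply: H.
Qed.

Lemma while_inv (S : Type) (I : S -> Prop) (c : S -> bool) (f : S -> S) k s :
  (forall t, I t -> c t -> I (f t)) -> I s -> I (while k c f s).
Proof.
move=> step; elim: k s => //= k IH s Is.
by case: ifP => // cs; apply: IH; apply: step.
Qed.

(** The state of a round once the vertices outside [X'] have been treated.  The
    separation of slopes is what makes membership in [Y'] equivalent to the
    presence of a lower leftmost edge. *)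
Definition round_inv (m n : nat) (G : {set 'I_m * 'I_n})
    (st : {set 'I_m} * {set 'I_n} * {set 'I_m * 'I_n}) : Prop :=
  let: (X', Y', Mk) := st in
  [/\ forall p q, p \in leftmost G -> q \in leftmost G ->
        p.1 \notin X' -> q.1 \in X' -> slope p < slope q,
      Y' = [set p.2 | p in leftmost G & p.1 \notin X']
    & Mk = [set p in lowest (leftmost G) | p.1 \notin X']].

(** The edges treated by a step are the leftmost edges of smallest slope among
    the remaining vertices: an edge of smallest slope is leftmost at its own end
    in [X], and conversely no edge has smaller slope than the leftmost one at
    its end. *)
Lemma round_step_inv m n (G : {set 'I_m * 'I_n}) st :
  round_inv G st -> round_inv G (round_step G st).
Proof.
case: st => -[X' Y'] Mk [sep defY defM] /=.
set M := min_slope_edges _.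
have inM p : p \in M ->
    [/\ p \in leftmost G, p.1 \in X'
      & forall q, q \in leftmost G -> q.1 \in X' -> slope p <= slope q].
  move=> Mp; rewrite !inE in Mp.
  case/andP: Mp => /andP[Gp Xp] /forall_inP minp; split=> //.
    apply/leftmostP; split=> // q Gq qp.
    have /minp : q \in induced_edges G X' by rewrite inE Gq qp.
    by rewrite /slope qp lerD2r lez_nat.
  by move=> q /leftmostP[Gq _] Xq; apply: minp; rewrite inE Gq.
have Mmin p : p \in leftmost G -> p.1 \in X' ->
    (forall q, q \in leftmost G -> q.1 \in X' -> slope p <= slope q) -> p \in M.
  move=> Lp Xp minp; rewrite !inE Xp; have /leftmostP[-> _] := Lp.
  apply/forall_inP => q; rewrite inE => /andP[Gq Xq].
  have [r Lr [rq ler]] := leftmost_ex Gq.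
  have := minp r Lr; rewrite rq => /(_ Xq) lepr.
  by apply: le_trans lepr _; rewrite /slope rq lerD2r lez_nat.
have doneE p : p \in leftmost G ->
    (p.1 \notin X' :\: [set q.1 | q in M]) = (p.1 \notin X') || (p \in M).
  move=> Lp; rewrite inE negb_and negbK orbC; congr (_ || _).
  apply/imsetP/idP => [[q Mq pq]|Mp]; last by exists p.
  by have [Lq _ _] := inM q Mq; rewrite (leftmost_inj Lp Lq pq).
split.
- move=> p q Lp Lq; rewrite doneE // => donep.
  rewrite -[_ \in _]negbK doneE // negb_or negbK => /andP[Xq nMq].
  case/orP: donep => [nXp|Mp]; first exact: sep.
  have [_ _ minp] := inM p Mp; rewrite lt_neqAle minp // andbT.
  apply: contra nMq => /eqP pq; apply: Mmin => // r; rewrite -pq; exact: minp.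
- apply/setP => j; rewrite defY inE; apply/orP/imsetP.
    case=> /imsetP[p]; first rewrite inE => /andP[Lp nXp] ->.
      by exists p => //; rewrite inE Lp doneE // nXp.
    move=> Mp ->; have [Lp _ _] := inM p Mp.
    by exists p => //; rewrite inE Lp doneE // Mp orbT.
  case=> p; rewrite inE => /andP[Lp]; rewrite doneE // => /orP[nXp|Mp] ->.
    by left; apply/imsetP; exists p; rewrite // inE Lp.
  by right; apply: imset_f.
apply/setP => p; rewrite defM in_setU.
rewrite [X in X || _]in_set [X in _ || X]in_set [RHS]in_set.
have [Lp|nLp] := boolP (p \in leftmost G); last first.
  have /negbTE -> : p \notin lowest (leftmost G).
    by apply: contra nLp => /lowestP[].
  have /negbTE -> // : p \notin M by apply: contra nLp => /inM[].
rewrite doneE // andb_orr; congr (_ || _).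
have [Mp|] := boolP (p \in M); last by rewrite !andbF.
have [_ Xp minp] := inM p Mp; rewrite !andbT.
(* At a common end in Y, a smaller slope means a larger index in X. *)
apply/idP/lowestP => [nYp|[_ lowp]].
  split=> // q Lq qp; rewrite leqNgt; apply/negP => ltpq.
  case/negP: nYp; rewrite defY -qp; apply/imsetP; exists q => //.
  rewrite inE Lq; apply/negP => /(minp q Lq).
  by rewrite /slope qp lerD2l lerN2 lez_nat leqNgt ltpq.
rewrite defY; apply/imsetP => -[q]; rewrite inE => /andP[Lq nXq] pq.
have := lowp q Lq (esym pq); have := sep q p Lq Lp nXq Xp.
by rewrite /slope pq ltrD2l ltrN2 ltz_nat ltnNge => /negP.
Qed.

Lemma slope_round_lowest m n (G : {set 'I_m * 'I_n}) :
  slope_round G = lowest (leftmost G).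
Proof.
have : round_inv G (round_loop G).
  apply: while_inv => [st I _|]; first exact: round_step_inv.
  have X0 p : p \in leftmost G -> p.1 \in [set q.1 | q in G].
    by case/leftmostP => Gp _; apply: imset_f.
  split.
  - by move=> p q Lp _; rewrite X0.
  - apply/esym/eqP; rewrite -subset0; apply/subsetP => j /imsetP[p].
    by rewrite inE => /andP[/X0 ->].
  apply/setP => p; rewrite [RHS]inE in_set0; apply/esym/negP.
  by case/andP => /lowestP[/X0 ->].
have := round_loop_exit G; rewrite /slope_round.
case: (round_loop G) => -[X' Y'] Mk /= -> [_ _ ->].
by apply/setP => p; rewrite inE in_set0 andbT.
Qed.

(** * Weights *)

(** The position of [(p.2, p.1)] in the lexicographic order. *)
Definition rank m n (p : 'I_m * 'I_n) : nat := p.2 * m + p.1.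

Definition rankx m n (L : {set 'I_m * 'I_n}) (i : 'I_m) : nat :=
  \max_(p in L | p.1 == i) rank p.

(** For [y_j] without leftmost edges the value is [j * m], still above the rank
    of all edges to vertices before [y_j]. *)
Definition ranky m n (L : {set 'I_m * 'I_n}) (j : 'I_n) : nat :=
  j * m + \max_(p in L | p.2 == j) p.1.

Lemma rankx_leftmost m n (G : {set 'I_m * 'I_n}) p :
  p \in leftmost G -> rankx (leftmost G) p.1 = rank p.
Proof.
move=> Lp; rewrite /rankx (bigD1 p) /=; last by rewrite Lp eqxx.
rewrite big1 ?maxn0 // => q /andP[/andP[Lq /eqP qp]].
by rewrite (leftmost_inj Lq Lp qp) eqxx.
Qed.

Lemma rankx_selected m n (G : {set 'I_m * 'I_n}) p :
  p \in lowest (leftmost G) ->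
  rankx (leftmost G) p.1 = ranky (leftmost G) p.2.
Proof.
case/lowestP => Lp lowp; rewrite rankx_leftmost // /rank /ranky; congr addn.
apply/eqP; rewrite eqn_leq; apply/andP; split.
  by apply: (@leq_bigmax_cond _ _ (fun q => nat_of_ord q.1)); rewrite Lp eqxx.
by apply/bigmax_leqP => q /andP[Lq /eqP]; apply: lowp.
Qed.

(** An edge that is not leftmost loses on the first component of the rank, a
    leftmost one that is not lowest on the second. *)
Lemma rankx_unselected m n (G : {set 'I_m * 'I_n}) p :
  p \in G -> p \notin lowest (leftmost G) ->
  (rankx (leftmost G) p.1 < ranky (leftmost G) p.2)%N.
Proof.
move=> Gp nlow; have [q Lq [qp leq2]] := leftmost_ex Gp.
rewrite -qp rankx_leftmost // /rank /ranky.
move: leq2; rewrite leq_eqVlt => /orP[/eqP eq2|lt2]; last first.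
  apply: leq_trans (leq_addr _ _); apply: leq_trans (leq_mul lt2 (leqnn m)).
  by rewrite mulSn addnC ltn_add2r.
rewrite eq2 ltn_add2l.
have pq : p = q.
  by case: p q qp eq2 {Gp nlow Lq} => [i j] [i' j'] /= -> /val_inj ->.
move: nlow; rewrite inE pq Lq /= => /forall_inPn[r Lr].
rewrite negb_imply -ltnNge => /andP[/eqP rq ltr].
apply: leq_trans ltr _.
by apply: (@leq_bigmax_cond _ _ (fun q => nat_of_ord q.1)); rewrite Lr rq eqxx.
Qed.

(** * From index pairs to edges *)

Section Labeled.
Variables (R : realType) (V : finType) (e : rel V) (m n : nat).
Variables (x : 'I_m -> V) (y : 'I_n -> V).
Hypothesis e_bip : labeled_bipartition e x y.

Lemma edge_eq (p : 'I_m * 'I_n) i j :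
  [set x i; y j] = [set x p.1; y p.2] -> p = (i, j).
Proof.
case: e_bip => -[injx injy] nxy _ _ _ eqE.
have : x i \in [set x p.1; y p.2] by rewrite -eqE set21.
have : y j \in [set x p.1; y p.2] by rewrite -eqE set22.
rewrite !inE => /orP[/eqP/esym/nxy //|/eqP/injy ->].
by move=> /orP[/eqP/injx ->|/eqP/nxy //]; case: p {eqE}.
Qed.

Lemma edge_inj : injective (fun p : 'I_m * 'I_n => [set x p.1; y p.2]).
Proof. by move=> [i j] p /= /edge_eq. Qed.

(** Positivity speaks of unordered pairs, while weights are attached to the two
    parts: this orients an edge from [X] to [Y]. *)
Lemma in_edges_of_pairs (G : {set 'I_m * 'I_n}) u v :
  [set u; v] \in edges_of_pairs x y G ->
  exists2 p, p \in G & (u, v) = (x p.1, y p.2) \/ (v, u) = (x p.1, y p.2).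
Proof.
case/imsetP => p Gp eqE; exists p => //; case: e_bip => _ nxy _ _ _.
have : x p.1 \in [set u; v] by rewrite eqE set21.
have : y p.2 \in [set u; v] by rewrite eqE set22.
rewrite !inE => /orP[] /eqP ey /orP[] /eqP ex; rewrite -?ex -?ey;
  try (by case: (nxy p.1 p.2); rewrite ex ey); by [left | right].
Qed.

Lemma edges_of_pairsD (G M : {set 'I_m * 'I_n}) :
  edges_of_pairs x y (G :\: M) = edges_of_pairs x y G :\: edges_of_pairs x y M.
Proof.
apply/setP => A; apply/imsetP/setDP.
  by case=> p /setDP[Gp nMp] ->; split; rewrite (mem_imset _ _ edge_inj).
case=> /imsetP[p Gp ->]; rewrite (mem_imset _ _ edge_inj) => nMp.
by exists p => //; rewrite inE nMp.
Qed.

Lemma edge_set_bipartite :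
  symmetric e -> edge_set e = edges_of_pairs x y (bipartite_edges e x y).
Proof.
move=> e_sym; case: e_bip => _ _ cover ex ey.
apply/setP => A; apply/imsetP/imsetP => -[p]; rewrite inE => ep ->; last first.
  by exists (x p.1, y p.2); rewrite ?inE.
case: p ep => u v /= ep.
case: (cover u) (cover v) ep => -[i ->] [] [j ->].
- by rewrite (negbTE (ex _ _)).
- by exists (i, j); rewrite ?inE.
- by rewrite e_sym => ep; exists (j, i); rewrite ?inE // setUC.
- by rewrite (negbTE (ey _ _)).
Qed.

Lemma slope_round_matching (G : {set 'I_m * 'I_n}) :
  matching (edges_of_pairs x y G) (edges_of_pairs x y (slope_round G)).
Proof.
rewrite slope_round_lowest; split.
  by apply/imsetS/subsetP => p /lowestP[/leftmostP[]].
apply/trivIsetP => A B /imsetP[p Sp ->] /imsetP[q Sq ->] neq.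
have [Lp lowp] := lowestP _ _ Sp; have [Lq lowq] := lowestP _ _ Sq.
have neq1 : p.1 != q.1.
  by apply: contra neq => /eqP/(leftmost_inj Lp Lq) ->.
have neq2 : p.2 != q.2.
  apply: contra neq1 => /eqP pq; rewrite -val_eqE eqn_leq /=.
  by rewrite lowp ?lowq.
case: e_bip => -[injx injy] nxy _ _ _.
rewrite disjoints_subset; apply/subsetP => v; rewrite !inE negb_or.
case/orP=> /eqP ->; rewrite ?(inj_eq injx) ?(inj_eq injy) ?neq1 ?neq2 ?andbT /=;
  apply/eqP => H; [exact: (nxy _ _ H) | exact: (nxy _ _ (esym H))].
Qed.

Lemma slope_round_positive (G : {set 'I_m * 'I_n}) :
  positive_matching R (edges_of_pairs x y G)
                      (edges_of_pairs x y (slope_round G)).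
Proof.
split; first exact: slope_round_matching.
case: (e_bip) => -[injx injy] nxy _ _ _; set L := leftmost G.
(* Ranks are doubled so that the constant 1 separates equal from unequal. *)
pose w v : R := if [pick i | x i == v] is Some i then (rankx L i).*2%:R
  else if [pick j | y j == v] is Some j then 1 - (ranky L j).*2%:R else 0.
have wx i : w (x i) = (rankx L i).*2%:R.
  rewrite /w; case: pickP => [i' /eqP/injx -> //|/(_ i)].
  by rewrite eqxx.
have wy j : w (y j) = 1 - (ranky L j).*2%:R.
  rewrite /w; case: pickP => [i /eqP/nxy //|_].
  by case: pickP => [j' /eqP/injy -> //|/(_ j)]; rewrite eqxx.
exists w; rewrite -edges_of_pairsD slope_round_lowest; split=> u v.
  case/in_edges_of_pairs => p /rankx_selected eqr.
  have pos : 0 < w (x p.1) + w (y p.2) by rewrite wx wy eqr subrKC.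
  by case=> -[-> ->] //; rewrite addrC.
case/in_edges_of_pairs => p /setDP[Gp nSp].
have neg : w (x p.1) + w (y p.2) < 0.
  have : ((rankx L p.1).*2.+2 <= (ranky L p.2).*2)%N.
    by rewrite -doubleS leq_double rankx_unselected.
  by rewrite wx wy -(ler_nat R) -!natr1; lra.
by case=> -[-> ->] //; rewrite addrC.
Qed.

(** The list of earlier matchings is only an accumulator, which allows an
    induction that puts the first matching at the head. *)
Lemma slope_loop_cat k (G : {set 'I_m * 'I_n}) Ms :
  (while k (fun st => st.1 != set0) (@slope_step m n) (G, Ms)).2 =
  Ms ++ (while k (fun st => st.1 != set0) (@slope_step m n) (G, [::])).2.
Proof.
elim: k G Ms => [|k IH] G Ms /=; first by rewrite cats0.
case: ifP => _ /=; last by rewrite cats0.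
by rewrite IH [in RHS]IH cat_rcons.
Qed.

Lemma slope_loop_pmd k (G : {set 'I_m * 'I_n}) :
  (#|G| <= k)%N ->
  pmd R (edges_of_pairs x y G)
    [seq edges_of_pairs x y M
       | M <- (while k (fun st => st.1 != set0) (@slope_step m n) (G, [::])).2].
Proof.
have pmd0 : pmd R (edges_of_pairs x y set0) [::].
  by rewrite /edges_of_pairs imset0; apply: pmd_nil.
elim: k G => [|k IH] G /=; first by rewrite leqn0 cards_eq0 => /eqP ->.
case: eqP => [-> //|/eqP G0 leG] /=; rewrite slope_loop_cat /=.
have /set0Pn[p] := slope_round_meets G0; rewrite inE => /andP[Gp Rp].
apply: pmd_cons.
  by apply/set0Pn; exists [set x p.1; y p.2]; apply: imset_f.
  exact: slope_round_positive.
rewrite -edges_of_pairsD; apply: IH; rewrite -ltnS (leq_trans _ leG) //.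
apply: proper_card; rewrite properE subsetDl; apply/subsetPn; exists p => //.
by rewrite inE Rp.
Qed.
End Labeled.

Theorem theorem3p11 (R : realType) (V : finType) (e : rel V)
    (e_sym : symmetric e) (e_irr : irreflexive e) (e_conn : connected e)
    (m n : nat) (x : 'I_m -> V) (y : 'I_n -> V)
    (e_bip : labeled_bipartition e x y) :
  pmd R (edge_set e) (slope_output e x y).
Proof.
rewrite (edge_set_bipartite e_bip e_sym).
exact: (slope_loop_pmd R e_bip (leqnn _)).
Qed.
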